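(* Let $\mathcal{Q}$ be a small quantaloid and let $\phi:\mathbb{A}\rightsquigarrow\mathbb{B}$ be a $\mathcal{Q}$-distributor between $\mathcal{Q}$-categories. Let $\phi_{\uparrow}:\mathcal{P}\mathbb{A}\to\mathcal{P}^{\dagger}\mathbb{B}$ and $\phi^{\downarrow}:\mathcal{P}^{\dagger}\mathbb{B}\to\mathcal{P}\mathbb{A}$ be the $\mathcal{Q}$-functors given by $\phi_{\uparrow}(\mu)=\phi\swarrow\mu$ and $\phi^{\downarrow}(\lambda)=\lambda\searrow\phi$. Then $\phi_{\uparrow}$ is left adjoint to $\phi^{\downarrow}$ as $\mathcal{Q}$-functors, i.e. $\phi_{\uparrow}\dashv\phi^{\downarrow}$ in $\mathcal{Q}\text{-}\mathbf{Cat}$.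
   Context: A quantaloid $\mathcal{Q}$ is a category whose hom-sets are complete lattices and whose composition preserves arbitrary joins in each variable; it is small if its objects $\mathcal{Q}_0$ and arrows form sets. For $f:X\to Y$, $g:Y\to Z$, $h:X\to Z$ in a quantaloid, $h\swarrow f:Y\to Z$ is the largest arrow with $(h\swarrow f)\circ f\le h$, and $g\searrow h:X\to Y$ is the largest arrow with $g\circ(g\searrow h)\le h$. A $\mathcal{Q}$-category $\mathbb{A}$ is a set $\mathbb{A}_0$ with a type map $t:\mathbb{A}_0\to\mathcal{Q}_0$ and hom-arrows $\mathbb{A}(x,y)\in\mathcal{Q}(tx,ty)$ with $1_{tx}\le\mathbb{A}(x,x)$ and $\mathbb{A}(y,z)\circ\mathbb{A}(x,y)\le\mathbb{A}(x,z)$. A $\mathcal{Q}$-functor $F:\mathbb{A}\to\mathbb{B}$ is a type-preserving map with $\mathbb{A}(x,x')\le\mathbb{B}(Fx,Fx')$. The underlying preorder on $\mathbb{A}_0$ is: $x\le y$ iff $tx=ty$ and $1_{tx}\le\mathbb{A}(x,y)$; $\mathcal{Q}$-functors are ordered pointwise. $\mathcal{Q}$-categories and $\mathcal{Q}$-functors form $\mathcal{Q}\text{-}\mathbf{Cat}$. An adjunction $F\dashv G$ of $\mathcal{Q}$-functors $F:\mathbb{A}\to\mathbb{B}$, $G:\mathbb{B}\to\mathbb{A}$ means $1_{\mathbb{A}}\le G\circ F$ and $F\circ G\le 1_{\mathbb{B}}$. A $\mathcal{Q}$-distributor $\phi:\mathbb{A}\rightsquigarrow\mathbb{B}$ assigns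 to each $(x,y)\in\mathbb{A}_0\times\mathbb{B}_0$ an arrow $\phi(x,y)\in\mathcal{Q}(tx,ty)$ with $\mathbb{B}(y',y)\circ\phi(x,y')\le\phi(x,y)$ and $\phi(x',y)\circ\mathbb{A}(x,x')\le\phi(x,y)$. $\mathcal{Q}$-categories and $\mathcal{Q}$-distributors form a quantaloid $\mathcal{Q}\text{-}\mathbf{Dist}$ with pointwise order, composition $(\psi\circ\phi)(x,z)=\bigvee_y\psi(y,z)\circ\phi(x,y)$, identities given by hom-arrows, and implications $(\eta\swarrow\phi)(y,z)=\bigwedge_x\eta(x,z)\swarrow\phi(x,y)$, $(\psi\searrow\eta)(x,y)=\bigwedge_z\psi(y,z)\searrow\eta(x,z)$. For $X\in\mathcal{Q}_0$, $*_X$ is the $\mathcal{Q}$-category with one object of type $X$ and hom-arrow $1_X$. $\mathcal{P}\mathbb{A}$ has as objects of type $X$ the distributors $\mu:\mathbb{A}\rightsquigarrow *_X$, with $\mathcal{P}\mathbb{A}(\mu,\lambda)=\lambda\swarrow\mu$. $\mathcal{P}^{\dagger}\mathbb{A}$ has as objects of type $X$ the distributors $\mu:*_X\rightsquigarrow\mathbb{A}$, with $\mathcal{P}^{\dagger}\mathbb{A}(\mu,\lambda)=\lambda\searrow\mu$. *)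

(* Defs.v *)
From Stdlib Require Import Relation_Definitions.
From mathcomp Require Import ssreflect ssrfun.

Set Implicit Arguments.
Unset Strict Implicit.
Unset Printing Implicit Defensive.

Declare Scope quantaloid_scope.
Delimit Scope quantaloid_scope with Q.
Local Open Scope quantaloid_scope.

(* A quantaloid whose objects and arrows form types, hence a small one.  The
   completeness of the hom-sets is given by a join of every subset; meets are
   derived in [qinf]. *)
Record quantaloid := Quantaloid {
  qobj :> Type;
  qhom : qobj -> qobj -> Type;
  qid : forall X, qhom X X;
  qcomp : forall X Y Z, qhom Y Z -> qhom X Y -> qhom X Z;
  qle : forall X Y, relation (qhom X Y);
  qsup : forall X Y, (qhom X Y -> Prop) -> qhom X Y;
  qcompA : forall X Y Z W (h : qhom Z W) (g : qhom Y Z) (f : qhom X Y),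
    qcomp h (qcomp g f) = qcomp (qcomp h g) f;
  qcomp1f : forall X Y (f : qhom X Y), qcomp (qid Y) f = f;
  qcompf1 : forall X Y (f : qhom X Y), qcomp f (qid X) = f;
  qle_order : forall X Y, order (qhom X Y) (@qle X Y);
  qsup_ub : forall X Y (S : qhom X Y -> Prop) f, S f -> qle f (qsup S);
  qsup_le : forall X Y (S : qhom X Y -> Prop) g,
    (forall f, S f -> qle f g) -> qle (qsup S) g;
  qcomp_supl : forall X Y Z (S : qhom Y Z -> Prop) (f : qhom X Y),
    qcomp (qsup S) f = qsup (fun h => exists2 g, S g & h = qcomp g f);
  qcomp_supr : forall X Y Z (g : qhom Y Z) (S : qhom X Y -> Prop),
    qcomp g (qsup S) = qsup (fun h => exists2 f, S f & h = qcomp g f)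
}.

Arguments qhom {q} X Y.
Arguments qid {q} X.

Notation "f ⊑ g" := (qle f g) (at level 70) : quantaloid_scope.
Notation "g ∘ f" := (qcomp g f) (at level 40, left associativity)
  : quantaloid_scope.

Section Implications.
Variable Q : quantaloid.

Definition qinf (X Y : Q) (S : qhom X Y -> Prop) : qhom X Y :=
  qsup (fun g => forall f, S f -> g ⊑ f).

Definition qmeet (X Y : Q) (I : Type) (F : I -> qhom X Y) : qhom X Y :=
  qinf (fun f => exists i, f = F i).

Definition lres (X Y Z : Q) (h : qhom X Z) (f : qhom X Y) : qhom Y Z :=
  qsup (fun g => g ∘ f ⊑ h).

Definition rres (X Y Z : Q) (g : qhom Y Z) (h : qhom X Z) : qhom X Y :=
  qsup (fun f => g ∘ f ⊑ h).

(* Transport of an arrow along equalities of its source and target; types of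
   objects of a Q-category are compared by propositional equality. *)
Definition qcast (X X' Y Y' : Q) (eX : X = X') (eY : Y = Y') (f : qhom X Y) :
    qhom X' Y' :=
  match eX in _ = X1, eY in _ = Y1 return qhom X1 Y1 with
  | erefl, erefl => f
  end.

End Implications.

Notation "h ↙ f" := (lres h f) (at level 45) : quantaloid_scope.
Notation "g ↘ h" := (rres g h) (at level 45) : quantaloid_scope.

Section Order.
Variable Q : quantaloid.

Lemma qle_refl (X Y : Q) (f : qhom X Y) : f ⊑ f.
Proof. exact: ord_refl _ _ (qle_order X Y) f. Qed.

Lemma qle_trans (X Y : Q) (g f h : qhom X Y) : f ⊑ g -> g ⊑ h -> f ⊑ h.
Proof. exact: ord_trans _ _ (qle_order X Y) f g h. Qed.

Lemma qle_anti (X Y : Q) (f g : qhom X Y) : f ⊑ g -> g ⊑ f -> f = g.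
Proof. exact: ord_antisym _ _ (qle_order X Y) f g. Qed.

Lemma qsup_pair (X Y : Q) (f g : qhom X Y) :
  f ⊑ g -> qsup (fun h => h = f \/ h = g) = g.
Proof.
move=> fg; apply: qle_anti; last by apply: qsup_ub; right.
by apply: qsup_le => h [->|->] //; exact: qle_refl.
Qed.

Lemma qcomp_lel (X Y Z : Q) (g g' : qhom Y Z) (f : qhom X Y) :
  g ⊑ g' -> g ∘ f ⊑ g' ∘ f.
Proof.
move=> gg'; rewrite -(qsup_pair gg') qcomp_supl.
by apply: qsup_ub; exists g => //; left.
Qed.

Lemma qcomp_ler (X Y Z : Q) (g : qhom Y Z) (f f' : qhom X Y) :
  f ⊑ f' -> g ∘ f ⊑ g ∘ f'.
Proof.
move=> ff'; rewrite -(qsup_pair ff') qcomp_supr.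
by apply: qsup_ub; exists f => //; left.
Qed.

Lemma qmeet_lb (X Y : Q) (I : Type) (F : I -> qhom X Y) i : qmeet F ⊑ F i.
Proof. by apply: qsup_le => g; apply; exists i. Qed.

Lemma le_qmeet (X Y : Q) (I : Type) (F : I -> qhom X Y) g :
  (forall i, g ⊑ F i) -> g ⊑ qmeet F.
Proof. by move=> gF; apply: qsup_ub => _ [i ->]. Qed.

Lemma lres_counit (X Y Z : Q) (h : qhom X Z) (f : qhom X Y) : (h ↙ f) ∘ f ⊑ h.
Proof. by rewrite qcomp_supl; apply: qsup_le => _ [g gP ->]. Qed.

Lemma le_lres (X Y Z : Q) (h : qhom X Z) (f : qhom X Y) (g : qhom Y Z) :
  g ∘ f ⊑ h -> g ⊑ h ↙ f.
Proof. by move=> gf; apply: qsup_ub. Qed.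

Lemma rres_counit (X Y Z : Q) (g : qhom Y Z) (h : qhom X Z) : g ∘ (g ↘ h) ⊑ h.
Proof. by rewrite qcomp_supr; apply: qsup_le => _ [f fP ->]. Qed.

Lemma le_rres (X Y Z : Q) (g : qhom Y Z) (h : qhom X Z) (f : qhom X Y) :
  g ∘ f ⊑ h -> f ⊑ g ↘ h.
Proof. by move=> gf; apply: qsup_ub. Qed.

Lemma qcast_le (X X' Y Y' : Q) (eX : X = X') (eY : Y = Y') (f g : qhom X Y) :
  f ⊑ g -> qcast eX eY f ⊑ qcast eX eY g.
Proof. by case: X' / eX; case: Y' / eY. Qed.

Lemma qcast_trans (X X' X'' Y Y' Y'' : Q) (eX : X = X') (eX' : X' = X'')
    (eY : Y = Y') (eY' : Y' = Y'') (f : qhom X Y) :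
  qcast eX' eY' (qcast eX eY f) = qcast (etrans eX eX') (etrans eY eY') f.
Proof. by case: X'' / eX'; case: Y'' / eY'. Qed.

End Order.

Record qcat (Q : quantaloid) := QCat {
  qcat_obj :> Type;
  qtype : qcat_obj -> Q;
  qcat_hom : forall x y, qhom (qtype x) (qtype y);
  qcat_id : forall x, qid (qtype x) ⊑ qcat_hom x x;
  qcat_comp : forall x y z, qcat_hom y z ∘ qcat_hom x y ⊑ qcat_hom x z
}.

Definition obj_le (Q : quantaloid) (A : qcat Q) (x y : A) : Prop :=
  exists e : qtype x = qtype y,
    qcast (erefl (qtype x)) e (qid (qtype x)) ⊑ qcat_hom x y.

Record qfunctor (Q : quantaloid) (A B : qcat Q) := QFunctor {
  qfun :> A -> B;
  qfun_type : forall x, qtype (qfun x) = qtype x;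
  qfun_hom : forall x x',
    qcat_hom x x' ⊑
      qcast (qfun_type x) (qfun_type x') (qcat_hom (qfun x) (qfun x'))
}.

Definition qfunctor_le (Q : quantaloid) (A B : qcat Q) (F G : qfunctor A B) :
    Prop :=
  forall x, obj_le (F x) (G x).

Section Functors.
Variable Q : quantaloid.

Definition qfunctor_id (A : qcat Q) : qfunctor A A :=
  @QFunctor Q A A id (fun=> erefl) (fun x x' => qle_refl (qcat_hom x x')).

Lemma qfunctor_comp_hom (A B C : qcat Q) (G : qfunctor B C) (F : qfunctor A B)
    (x x' : A) :
  qcat_hom x x' ⊑
    qcast (etrans (qfun_type G (F x)) (qfun_type F x))
          (etrans (qfun_type G (F x')) (qfun_type F x'))
          (qcat_hom (G (F x)) (G (F x'))).
Proof.
rewrite -qcast_trans; apply: qle_trans (qfun_hom F x x') _.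
exact/qcast_le/qfun_hom.
Qed.

Definition qfunctor_comp (A B C : qcat Q) (G : qfunctor B C)
    (F : qfunctor A B) : qfunctor A C :=
  @QFunctor Q A C (G \o F)
    (fun x => etrans (qfun_type G (F x)) (qfun_type F x))
    (qfunctor_comp_hom G F).

Definition left_adjoint (A B : qcat Q) (F : qfunctor A B) (G : qfunctor B A) :
    Prop :=
  qfunctor_le (qfunctor_id A) (qfunctor_comp G F) /\
  qfunctor_le (qfunctor_comp F G) (qfunctor_id B).

End Functors.

Record qdist (Q : quantaloid) (A B : qcat Q) := QDist {
  qdist_arr :> forall (x : A) (y : B), qhom (qtype x) (qtype y);
  qdist_l : forall x y' y, qcat_hom y' y ∘ qdist_arr x y' ⊑ qdist_arr x y;
  qdist_r : forall x x' y, qdist_arr x' y ∘ qcat_hom x x' ⊑ qdist_arr x y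
}.

Section DistImplications.
Variables (Q : quantaloid) (A B C : qcat Q).

Definition dist_lres_arr (eta : qdist A C) (phi : qdist A B) (y : B) (z : C) :
    qhom (qtype y) (qtype z) :=
  qmeet (fun x => eta x z ↙ phi x y).

Lemma dist_lres_l (eta : qdist A C) (phi : qdist A B) y z' z :
  qcat_hom z' z ∘ dist_lres_arr eta phi y z' ⊑ dist_lres_arr eta phi y z.
Proof.
apply: le_qmeet => x; apply: le_lres; rewrite -qcompA.
apply: qle_trans (qdist_l eta x z' z); apply: qcomp_ler.
by apply: qle_trans (lres_counit _ (phi x y)); apply/qcomp_lel/qmeet_lb.
Qed.

Lemma dist_lres_r (eta : qdist A C) (phi : qdist A B) y y' z :
  dist_lres_arr eta phi y' z ∘ qcat_hom y y' ⊑ dist_lres_arr eta phi y z.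
Proof.
apply: le_qmeet => x; apply: le_lres; rewrite -qcompA.
apply: qle_trans (lres_counit _ (phi x y')).
apply: qle_trans (qcomp_ler _ (qdist_l phi x y y')) _.
exact/qcomp_lel/qmeet_lb.
Qed.

Definition dist_lres (eta : qdist A C) (phi : qdist A B) : qdist B C :=
  QDist (dist_lres_l eta phi) (dist_lres_r eta phi).

Definition dist_rres_arr (psi : qdist B C) (eta : qdist A C) (x : A) (y : B) :
    qhom (qtype x) (qtype y) :=
  qmeet (fun z => psi y z ↘ eta x z).

Lemma dist_rres_l (psi : qdist B C) (eta : qdist A C) x y' y :
  qcat_hom y' y ∘ dist_rres_arr psi eta x y' ⊑ dist_rres_arr psi eta x y.
Proof.
apply: le_qmeet => z; apply: le_rres; rewrite qcompA.
apply: qle_trans (rres_counit (psi y' z) _).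
apply: qle_trans (qcomp_lel _ (qdist_r psi y' y z)) _.
exact/qcomp_ler/qmeet_lb.
Qed.

Lemma dist_rres_r (psi : qdist B C) (eta : qdist A C) x x' y :
  dist_rres_arr psi eta x' y ∘ qcat_hom x x' ⊑ dist_rres_arr psi eta x y.
Proof.
apply: le_qmeet => z; apply: le_rres; rewrite qcompA.
apply: qle_trans (qdist_r eta x x' z); apply: qcomp_lel.
by apply: qle_trans (rres_counit (psi y z) _); apply/qcomp_ler/qmeet_lb.
Qed.

Definition dist_rres (psi : qdist B C) (eta : qdist A C) : qdist A B :=
  QDist (dist_rres_l psi eta) (dist_rres_r psi eta).

End DistImplications.

Declare Scope qdist_scope.
Delimit Scope qdist_scope with D.
Notation "eta ↙ phi" := (dist_lres eta phi) (at level 45) : qdist_scope.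
Notation "psi ↘ eta" := (dist_rres psi eta) (at level 45) : qdist_scope.

Section Presheaves.
Variable Q : quantaloid.

Lemma star_comp (X : Q) : qid X ∘ qid X ⊑ qid X.
Proof. rewrite qcompf1; exact: qle_refl. Qed.

Definition star (X : Q) : qcat Q :=
  @QCat Q unit (fun=> X) (fun _ _ => qid X) (fun=> qle_refl (qid X))
    (fun _ _ _ => star_comp X).

Variable A : qcat Q.

Definition psh_obj : Type := {X : Q & qdist A (star X)}.
Definition copsh_obj : Type := {X : Q & qdist (star X) A}.

(* [tt] selects the only hom-arrow of a distributor from [star X] to [star Y]. *)
Definition psh_hom (mu la : psh_obj) : qhom (projT1 mu) (projT1 la) :=
  (projT2 la ↙ projT2 mu)%D tt tt.

Definition copsh_hom (mu la : copsh_obj) : qhom (projT1 mu) (projT1 la) :=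
  (projT2 la ↘ projT2 mu)%D tt tt.

Lemma psh_id mu : qid (projT1 mu) ⊑ psh_hom mu mu.
Proof.
by apply: le_qmeet => x; apply: le_lres; rewrite qcomp1f; exact: qle_refl.
Qed.

Lemma psh_comp mu nu la : psh_hom nu la ∘ psh_hom mu nu ⊑ psh_hom mu la.
Proof.
apply: le_qmeet => x; apply: le_lres; rewrite -qcompA.
apply: qle_trans (lres_counit _ (projT2 nu x tt)).
apply: qle_trans (qcomp_lel _ (qmeet_lb _ x)) _; apply: qcomp_ler.
apply: qle_trans (qcomp_lel _ (qmeet_lb _ x)) _; exact: lres_counit.
Qed.

Definition psh : qcat Q := QCat psh_id psh_comp.

Lemma copsh_id mu : qid (projT1 mu) ⊑ copsh_hom mu mu.
Proof.
by apply: le_qmeet => x; apply: le_rres; rewrite qcompf1; exact: qle_refl.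
Qed.

Lemma copsh_comp mu nu la :
  copsh_hom nu la ∘ copsh_hom mu nu ⊑ copsh_hom mu la.
Proof.
apply: le_qmeet => x; apply: le_rres; rewrite qcompA.
apply: qle_trans (rres_counit (projT2 nu tt x) _).
apply: qle_trans (qcomp_ler _ (qmeet_lb _ x)) _; apply: qcomp_lel.
apply: qle_trans (qcomp_ler _ (qmeet_lb _ x)) _; exact: rres_counit.
Qed.

Definition copsh : qcat Q := QCat copsh_id copsh_comp.

End Presheaves.

Section Isbell.
Variables (Q : quantaloid) (A B : qcat Q) (phi : qdist A B).

Definition isbell_up_fun (mu : psh A) : copsh B :=
  existT _ (projT1 mu) (phi ↙ projT2 mu)%D.

Definition isbell_down_fun (la : copsh B) : psh A :=
  existT _ (projT1 la) (projT2 la ↘ phi)%D.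

Lemma isbell_up_hom (mu mu' : psh A) :
  qcat_hom mu mu' ⊑ qcat_hom (isbell_up_fun mu) (isbell_up_fun mu').
Proof.
apply: le_qmeet => y; apply: le_rres; apply: le_qmeet => x; apply: le_lres.
rewrite -qcompA; apply: qle_trans (lres_counit _ (projT2 mu' x tt)).
apply: qle_trans (qcomp_lel _ (qmeet_lb _ x)) _; apply: qcomp_ler.
apply: qle_trans (qcomp_lel _ (qmeet_lb _ x)) _; exact: lres_counit.
Qed.

Lemma isbell_down_hom (la la' : copsh B) :
  qcat_hom la la' ⊑ qcat_hom (isbell_down_fun la) (isbell_down_fun la').
Proof.
apply: le_qmeet => x; apply: le_lres; apply: le_qmeet => y; apply: le_rres.
rewrite qcompA; apply: qle_trans (rres_counit (projT2 la tt y) _).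
apply: qle_trans (qcomp_ler _ (qmeet_lb _ y)) _; apply: qcomp_lel.
apply: qle_trans (qcomp_ler _ (qmeet_lb _ y)) _; exact: rres_counit.
Qed.

Definition isbell_up : qfunctor (psh A) (copsh B) :=
  @QFunctor Q (psh A) (copsh B) isbell_up_fun (fun=> erefl) isbell_up_hom.

Definition isbell_down : qfunctor (copsh B) (psh A) :=
  @QFunctor Q (copsh B) (psh A) isbell_down_fun (fun=> erefl) isbell_down_hom.

End Isbell.

(* Main.v *)
From mathcomp Require Import ssreflect.
Require Import Defs.

(** By residuation, the unit and the counit of the adjunction reduce to
    [(φ ↙ μ) ∘ μ ⊑ φ] and [λ ∘ (λ ↘ φ) ⊑ φ]. *)

Theorem proposition5p1p1 (Q : quantaloid) (A B : qcat Q) (phi : qdist A B) :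
  left_adjoint (isbell_up phi) (isbell_down phi).
Proof.
(* Both functors keep the type component definitionally, so the type equality is reflexivity and the
   cast on the identity arrow vanishes. *)
split=> [mu|la]; exists eq_refl.
- apply: le_qmeet => x; apply: le_lres; rewrite qcomp1f.
  apply: le_qmeet => y; apply: le_rres.
  (* The meet defining [φ ↙ μ] is bounded by its component at this same [x], which residuates
     against [μ x]. *)
  apply: qle_trans (lres_counit _ (projT2 mu x tt)).
  exact/qcomp_lel/qmeet_lb.
(* The order of [copsh B] reverses the pointwise one, so the counit asks for [λ ⊑ φ ↙ (λ ↘ φ)]. *)
- apply: le_qmeet => y; apply: le_rres; rewrite qcompf1.
  apply: le_qmeet => x; apply: le_lres.
  apply: qle_trans (rres_counit (projT2 la tt y) _).
  exact/qcomp_ler/qmeet_lb.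
Qed.
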